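(* Let $k\in\mathbb{Z}$, let $\alpha\in\mathrm{GL}_2^{+}(\mathbb{Q})$ and let $\Gamma\le\mathrm{SL}_2(\mathbb{Z})$ be a congruence subgroup. Let $\{\beta_j=\alpha_j\alpha\alpha_j'\}_{j\in J}$ (with $\alpha_j,\alpha_j'\in\Gamma$) be a set of representatives of the orbits $\Gamma\backslash\Gamma\alpha\Gamma$. Suppose that two multiplier systems $\chi,\chi':\Gamma\to\mathbb{S}^1$ are compatible at $\alpha$, i.e. the function $c_{\chi,\chi'}:\Gamma\alpha\Gamma\to\mathbb{S}^1$, $c_{\chi,\chi'}(\gamma_1\alpha\gamma_2)=\chi(\gamma_1)\chi'(\gamma_2)$ for $\gamma_1,\gamma_2\in\Gamma$, is well defined. For $f\in\mathcal{Q}_k(\Gamma,\chi)$ define $$T^{\infty}_{\alpha,\chi,\chi'}f=\sum_{j\in J}c_{\chi,\chi'}(\beta_j)^{-1}\,f|\beta_j,$$ where $|$ is the weight $k$ slash operator. Then $T^{\infty}_{\alpha,\chi,\chi'}f\in\mathcal{Q}_k(\Gamma,\chi')$.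
   Context: Multiplier systems on $\Gamma$ are group homomorphisms $\Gamma\to\mathbb{S}^1=\{z\in\mathbb{C}:|z|=1\}$. For $\gamma=\begin{pmatrix}a&b\\c&d\end{pmatrix}\in\mathrm{GL}_2^{+}(\mathbb{Q})$ let $j(\gamma,x)=cx+d$, or alternatively $j(\gamma,x)=|cx+d|$ (the same choice being used throughout; the statement is for either choice). The weight $k$ slash operator is $(f|\gamma)(x)=j(\gamma,x)^{-k}f\left(\frac{ax+b}{cx+d}\right)$ for $x\in\mathbb{Q}$ with $cx+d\ne0$; it satisfies $f|\gamma_1\gamma_2=(f|\gamma_1)|\gamma_2$ wherever both sides are defined. At the finitely many rational points where some $f|\beta_j$ is undefined, the value of $T^{\infty}_{\alpha,\chi,\chi'}f$ is assigned arbitrarily. $\mathcal{Q}_k(\Gamma,\chi)$ is the space of quantum modular forms of weight $k$ and multiplier system $\chi$ on $\Gamma$: functions $f:\mathbb{Q}\to\mathbb{C}$ such that for every $\gamma\in\Gamma$ the function $h_\gamma=f-\chi(\gamma)^{-1}f|\gamma$ can be extended smoothly to $\mathbb{R}$ except at finitely many points, i.e. there is a finite set $S\subset\mathbb{Q}$ and a $C^\infty$ function on $\mathbb{R}\setminus S$ agreeing with $h_\gamma$ on $\mathbb{Q}\setminus S$. *)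

(* Defs.v *)
From mathcomp Require Import all_boot all_order all_algebra.
From mathcomp Require Import complex.
From mathcomp Require Import all_classical all_reals all_analysis.

Set Implicit Arguments.
Unset Strict Implicit.
Unset Printing Implicit Defensive.

Import Order.TTheory GRing.Theory Num.Theory.
Import numFieldNormedType.Exports.

Local Open Scope classical_set_scope.
Local Open Scope ring_scope.

(* Elements of SL_2(Z) are integer matrices of determinant 1; a subgroup is a
   set of such matrices, and a function on it is a function on 'M[int]_2 whose
   values outside the subgroup are irrelevant. *)
Definition SL2Z : set 'M[int]_2 := [set g | \det g = 1].

Definition is_subgroup (G : set 'M[int]_2) : Prop :=
  [/\ G `<=` SL2Z,
      G 1%:M,
      forall g1 g2, G g1 -> G g2 -> G (g1 *m g2)
    & forall g, G g -> G (invmx g)].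

Definition principal_congruence (N : nat) : set 'M[int]_2 :=
  [set g | SL2Z g /\ forall i j, (N%:Z %| (g - 1%:M) i j)%Z].

Definition congruence_subgroup (G : set 'M[int]_2) : Prop :=
  is_subgroup G /\ exists2 N : nat, (0 < N)%N & principal_congruence N `<=` G.

Definition ratmx (g : 'M[int]_2) : 'M[rat]_2 := map_mx intr g.

Definition double_coset (G : set 'M[int]_2) (alpha : 'M[rat]_2) :
    set 'M[rat]_2 :=
  [set b | exists g1 g2, [/\ G g1, G g2 & b = ratmx g1 *m alpha *m ratmx g2]].

Definition orbit_representatives (G : set 'M[int]_2) (alpha : 'M[rat]_2)
    (J : Type) (beta : J -> 'M[rat]_2) : Prop :=
  (forall j, double_coset G alpha (beta j)) /\
  (forall b, double_coset G alpha b ->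
     exists! j : J, exists2 g, G g & b = ratmx g *m beta j).

Definition multiplier_system (R : realType) (G : set 'M[int]_2)
    (chi : 'M[int]_2 -> R[i]) : Prop :=
  (forall g, G g -> `|chi g| = 1) /\
  (forall g1 g2, G g1 -> G g2 -> chi (g1 *m g2) = chi g1 * chi g2).

Definition compatible (R : realType) (G : set 'M[int]_2) (alpha : 'M[rat]_2)
    (chi chi' : 'M[int]_2 -> R[i]) : Prop :=
  forall g1 g2 h1 h2, G g1 -> G g2 -> G h1 -> G h2 ->
    ratmx g1 *m alpha *m ratmx g2 = ratmx h1 *m alpha *m ratmx h2 ->
    chi g1 * chi' g2 = chi h1 * chi' h2.

(* Takes the junk value 1 outside the double coset. *)
Definition compat_fun (R : realType) (G : set 'M[int]_2) (alpha : 'M[rat]_2)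
    (chi chi' : 'M[int]_2 -> R[i]) (b : 'M[rat]_2) : R[i] :=
  xget 1 [set z | exists g1 g2,
    [/\ G g1, G g2, b = ratmx g1 *m alpha *m ratmx g2 & z = chi g1 * chi' g2]].

Definition denom (g : 'M[rat]_2) (x : rat) : rat := g 1 0 * x + g 1 1.

(* The boolean selects the convention: j = |cx + d| if true, cx + d if false. *)
Definition jfactor (abs : bool) (g : 'M[rat]_2) (x : rat) : rat :=
  if abs then `|denom g x| else denom g x.

(* Meaningful only where [denom g x != 0]; every use below is guarded. *)
Definition slash (R : realType) (abs : bool) (k : int) (f : rat -> R[i])
    (g : 'M[rat]_2) (x : rat) : R[i] :=
  (ratr (jfactor abs g x) : R[i]) ^ (- k) *
  f ((g 0 0 * x + g 0 1) / denom g x).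

(* C^oo on U, for U open: the real and imaginary parts have derivatives of all
   orders at every point of U. *)
Definition smooth_on (R : realType) (U : set R) (F : R -> R[i]) : Prop :=
  forall (n : nat) (x : R), U x ->
    derivable (derive1n n (fun t => complex.Re (F t))) x 1 /\
    derivable (derive1n n (fun t => complex.Im (F t))) x 1.

(* The exceptional set S has to contain the pole of [f | g], where the
   difference is undefined. *)
Definition quantum_modular (R : realType) (abs : bool) (k : int)
    (G : set 'M[int]_2) (chi : 'M[int]_2 -> R[i]) (f : rat -> R[i]) : Prop :=
  forall g, G g ->
    exists (S : set rat) (F : R -> R[i]),
      [/\ finite_set S,
          smooth_on (~` [set ratr q | q in S]) F
        & forall x : rat, ~ S x ->
            denom (ratmx g) x != 0 /\
            F (ratr x) = f x - (chi g)^-1 * slash abs k f (ratmx g) x].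

(* [Tf] is a version of the operator applied to [f]: the values at the poles of
   the [f | beta j] are arbitrary.  The index type J is not assumed finite: for
   a congruence subgroup its finiteness is a consequence of
   [orbit_representatives], and the finitely supported sum is then the sum over
   all of J. *)
Definition hecke_image (R : realType) (abs : bool) (k : int)
    (G : set 'M[int]_2) (alpha : 'M[rat]_2) (chi chi' : 'M[int]_2 -> R[i])
    (J : choiceType) (beta : J -> 'M[rat]_2) (f Tf : rat -> R[i]) : Prop :=
  forall x : rat, (forall j, denom (beta j) x != 0) ->
    Tf x = \sum_(j \in [set: J])
             (compat_fun G alpha chi chi' (beta j))^-1 *
             slash abs k f (beta j) x.

(* Main.v *)
(* Each beta_j g with g in G lies in the double coset, so beta_j g =
   h_j beta_(sigma j) for some h_j in G and a permutation sigma of J, and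
   compatibility gives chi'(g)^-1 c(beta_j)^-1 = c(beta_(sigma j))^-1 chi(h_j)^-1.
   Hence, off finitely many points,
     Tf - chi'(g)^-1 Tf | g
       = sum_j c(beta_(sigma j))^-1 (f - chi(h_j)^-1 f | h_j) | beta_(sigma j),
   and every summand is a smooth function composed with a Moebius map and
   multiplied by a power of the cocycle, which is smooth away from finitely many
   rational points.  J is finite because if g = 1 mod N d e, where d alpha and
   e alpha^-1 are integral, then alpha g alpha^-1 is integral and = 1 mod N, so
   the orbit of alpha g2 depends only on g2 modulo N d e. *)

Require Import Defs.
From mathcomp Require Import all_boot all_order all_algebra.
From mathcomp Require Import complex.
From mathcomp Require Import all_classical all_reals all_analysis.
From mathcomp Require Import ring.

Set Implicit Arguments.
Unset Strict Implicit.
Unset Printing Implicit Defensive.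

Import Order.TTheory GRing.Theory Num.Theory.
Import numFieldNormedType.Exports.

Local Open Scope ring_scope.
Local Open Scope classical_set_scope.

(** * Calculus of smooth functions on an open set *)

(** The first derivative is peeled off before the others, so that induction on [n] with the function
    generalised yields the sum, product, quotient and chain rules; [diffnP] relates this to the
    iterated derivatives in [smooth_on]. *)
Fixpoint diffn (R : realType) (n : nat) (U : set R) (u : R -> R) : Prop :=
  if n is m.+1 then
    (forall x, U x -> derivable u x 1) /\ diffn m U u^`()
  else True.

Section Diffn.
Variable R : realType.
Implicit Types (U V : set R) (u v : R -> R).

Lemma open_near U (x : R) : open U -> U x -> \near x, U x.
Proof. by move=> oU Ux; apply: open_nbhs_nbhs. Qed.

Lemma diffnP U u : (forall n, diffn n U u) <->
  (forall n x, U x -> derivable (derive1n n u) x 1).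
Proof.
split=> [H n|H n].
  elim: n u H => [|n IHn] u H x Ux; first by have [/(_ x Ux)] := H 1%N.
  by rewrite derive1Sn; apply: IHn => // m; have [] := H m.+1.
elim: n u H => // n IHn u H; split=> [x Ux|]; first exact: (H 0%N).
by apply: IHn => m x Ux; rewrite -derive1Sn; apply: H.
Qed.

Lemma diffnS n U u : diffn n.+1 U u -> diffn n U u.
Proof. by elim: n u => // n IHn u [du d2u]; split=> //; apply: IHn. Qed.

(** Since [U] is open, agreement on [U] is agreement near each of its points, so the derivatives
    agree on [U] too. This lets a derivative be replaced by a formula valid only on [U]. *)
Lemma eq_diffn n U u v : open U -> {in U, u =1 v} -> diffn n U u -> diffn n U v.
Proof.
move=> oU; elim: n u v => // n IHn u v uv [du ddu].
have near_uv x : U x -> \near x, u x = v x.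
  by move=> /(open_near oU); apply: filterS => y Uy; rewrite uv ?inE.
split=> [x Ux|]; first exact: (near_eq_derivable (near_uv x Ux) (du x Ux)).
apply: IHn ddu => x; rewrite inE => Ux.
by rewrite !derive1E; apply: near_eq_derive; exact: near_uv.
Qed.

Lemma diffnU n U V u : diffn n U u -> diffn n V u -> diffn n (U `|` V) u.
Proof.
elim: n u => // n IHn u [du ddu] [dv ddv]; split=> [x [/du|/dv]//|].
exact: IHn.
Qed.

Lemma diffn_sub n U V u : U `<=` V -> diffn n V u -> diffn n U u.
Proof.
move=> UV; elim: n u => // n IHn u [du ddu]; split=> [x /UV/du//|].
exact: IHn.
Qed.

Lemma diffn_cst n U (c : R) : diffn n U (fun=> c).
Proof.
elim: n c => // n IHn c; split=> // .
rewrite (_ : _^`() = fun=> 0 : R); first exact: IHn.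
by apply/funext => x; rewrite derive1_cst.
Qed.

Lemma diffn_id n U : diffn n U id.
Proof.
case: n => // n; split=> //.
rewrite (_ : _^`() = fun=> 1 : R); first exact: diffn_cst.
by apply/funext => x; rewrite derive1_id.
Qed.

Lemma diffnD n U u v : open U -> diffn n U u -> diffn n U v ->
  diffn n U (fun x => u x + v x).
Proof.
move=> oU; elim: n u v => // n IHn u v [du ddu] [dv ddv].
split=> [x Ux|]; first by apply: derivableD; [apply: du|apply: dv].
apply: eq_diffn (IHn _ _ ddu ddv) => // x; rewrite inE => Ux.
by rewrite !derive1E deriveD //; [apply: du|apply: dv].
Qed.

Lemma diffnM n U u v : open U -> diffn n U u -> diffn n U v ->
  diffn n U (fun x => u x * v x).
Proof.
move=> oU; elim: n u v => // n IHn u v Du Dv; move: (Du) (Dv) => [du ddu] [dv ddv].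
split=> [x Ux|]; first by apply: derivableM; [apply: du|apply: dv].
apply: (@eq_diffn _ _ (fun x => u x * derive1 v x + v x * derive1 u x)) => //.
  move=> x; rewrite inE => Ux.
  by rewrite !derive1E deriveM //; [apply: du|apply: dv].
by apply: diffnD => //; apply: IHn => //; apply: diffnS.
Qed.

Lemma diffnZ n U (c : R) u : open U -> diffn n U u ->
  diffn n U (fun x => c * u x).
Proof. by move=> oU; apply: diffnM => //; apply: diffn_cst. Qed.

(** The derivative $-u^{-2}u'$ contains $u^{-1}$ again, but only to order [n], which the induction
    hypothesis supplies. *)
Lemma diffn_inv n U u : open U -> (forall x, U x -> u x != 0) -> diffn n U u ->
  diffn n U (fun x => (u x)^-1).
Proof.
move=> oU u0; elim: n => // n IHn Du; move: (Du) => [du ddu].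
split=> [x Ux|]; first by apply: derivableV; [apply: u0|apply: du].
apply: (@eq_diffn _ _ (fun x => -1 * ((u x)^-1 * (u x)^-1 * derive1 u x))) => //.
  move=> x; rewrite inE => Ux; rewrite !derive1E deriveV; [|exact: u0|exact: du].
  by rewrite mulN1r scaleNr -exprVn expr2.
have Di := IHn (diffnS Du).
by apply: diffnZ => //; apply: diffnM => //; apply: diffnM.
Qed.

Lemma diffnX n U u m : open U -> diffn n U u -> diffn n U (fun x => u x ^+ m).
Proof.
move=> oU du; elim: m => [|m IHm].
  by rewrite (_ : (fun x => _) = fun=> 1) //; apply: diffn_cst.
rewrite (_ : (fun x => _) = fun x => u x * u x ^+ m); first exact: diffnM.
by apply/funext => x; rewrite exprS.
Qed.

Lemma diffn_exprz n U u (m : int) : open U -> (forall x, U x -> u x != 0) ->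
  diffn n U u -> diffn n U (fun x => u x ^ m).
Proof.
move=> oU u0 du; case: m => m; first exact: diffnX.
apply: diffn_inv => // [x Ux|]; last exact: diffnX.
by rewrite expf_neq0 ?u0.
Qed.

Lemma diffn_comp n U V u v : open U -> (forall x, U x -> V (v x)) ->
  diffn n V u -> diffn n U v -> diffn n U (u \o v).
Proof.
move=> oU UV; elim: n u v UV => // n IHn u v UV Du Dv.
move: (Du) (Dv) => [du ddu] [dv ddv].
split=> [x Ux|].
  apply/derivable1_diffP/differentiable_comp.
    by apply/derivable1_diffP/dv.
  by apply/derivable1_diffP/du/UV.
apply: (@eq_diffn _ _ (fun x => (derive1 u \o v) x * derive1 v x)) => //.
  by move=> x; rewrite inE => Ux; rewrite (derive1_comp (dv x Ux) (du _ (UV x Ux))).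
by apply: diffnM => //; apply: IHn => //; apply: diffnS.
Qed.

(** By continuity of [u], [U] is the union of the open sets where [u] is positive and where it is
    negative, and there the absolute value is [u] or [- u]. Order 0 is split off because continuity
    comes from the first derivative. *)
Lemma diffn_norm n U u : open U -> (forall x, U x -> u x != 0) ->
  diffn n U u -> diffn n U (fun x => `|u x|).
Proof.
case: n => // n oU u0 du.
have cu x : U x -> {for x, continuous u}.
  by move=> /du.1 /derivable1_diffP; exact: differentiable_continuous.
have oS (A : set R) : open A -> open (U `&` u @^-1` A).
  rewrite !openE => oA x [Ux Aux].
  by apply: filterI; [exact: open_near|exact/cu/open_near].
have [oP oN] := (oS _ (@open_gt R 0), oS _ (@open_lt R 0)).
apply: (@diffn_sub _ _ ((U `&` u @^-1` [set x | x > 0]) `|`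
                        (U `&` u @^-1` [set x | x < 0]))).
  by move=> x Ux /=; have := u0 x Ux; rewrite neq_lt => /orP[]; [right|left].
apply: diffnU.
  apply: eq_diffn (diffn_sub (@subIsetl _ _ _) du) => // x.
  by rewrite inE => -[_ /= ux]; rewrite gtr0_norm.
apply: eq_diffn (diffnZ (-1) oN (diffn_sub (@subIsetl _ _ _) du)) => // x.
by rewrite inE => -[_ /= ux]; rewrite ltr0_norm // mulN1r.
Qed.

Lemma diffn_affine n U (a b : R) : diffn n U (fun x => a * x + b).
Proof.
apply: (@diffn_sub _ _ setT) => //; apply: diffnD; first exact: openT.
  by apply: diffnZ; [exact: openT|exact: diffn_id].
exact: diffn_cst.
Qed.

End Diffn.

(** * Smooth complex-valued functions of a real variable *)

Section SmoothOn.
Variable R : realType.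
Implicit Types (U V : set R) (F G : R -> R[i]) (u : R -> R).

Lemma smooth_onP U F : smooth_on U F <->
  (forall n, diffn n U (fun t => complex.Re (F t))) /\
  (forall n, diffn n U (fun t => complex.Im (F t))).
Proof.
split=> [H|[HR HI] n x Ux].
  by split; apply/diffnP => n x Ux; have [] := H n x Ux.
by split; move: n x Ux; apply/diffnP.
Qed.

Lemma smooth_on_sub U V F : U `<=` V -> smooth_on V F -> smooth_on U F.
Proof. by move=> UV H n x /UV; apply: H. Qed.

Lemma smooth_on_real U u : (forall n, diffn n U u) ->
  smooth_on U (fun t => (u t)%:C%C).
Proof. by move=> du; apply/smooth_onP; split=> // n; apply: diffn_cst. Qed.

Lemma smooth_on_cst U (z : R[i]) : smooth_on U (fun=> z).
Proof. by apply/smooth_onP; split=> n; apply: diffn_cst. Qed.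

Lemma smooth_onD U F G : open U -> smooth_on U F -> smooth_on U G ->
  smooth_on U (fun t => F t + G t).
Proof.
move=> oU /smooth_onP[FR FI] /smooth_onP[GR GI]; apply/smooth_onP; split=> n.
  apply: (@eq_diffn _ _ _ (fun t => complex.Re (F t) + complex.Re (G t))) => //.
    by move=> t _; case: (F t) (G t) => [a b] [c d].
  exact: diffnD.
apply: (@eq_diffn _ _ _ (fun t => complex.Im (F t) + complex.Im (G t))) => //.
  by move=> t _; case: (F t) (G t) => [a b] [c d].
exact: diffnD.
Qed.

Lemma smooth_onM U F G : open U -> smooth_on U F -> smooth_on U G ->
  smooth_on U (fun t => F t * G t).
Proof.
move=> oU /smooth_onP[FR FI] /smooth_onP[GR GI]; apply/smooth_onP; split=> n.
  apply: (@eq_diffn _ _ _ (fun t => complex.Re (F t) * complex.Re (G t) +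
      -1 * (complex.Im (F t) * complex.Im (G t)))) => //.
    by move=> t _; case: (F t) (G t) => [a b] [c d] /=; rewrite mulN1r.
  by apply: diffnD => //; [|apply: diffnZ => //]; apply: diffnM.
apply: (@eq_diffn _ _ _ (fun t => complex.Re (F t) * complex.Im (G t) +
    complex.Im (F t) * complex.Re (G t))) => //.
  by move=> t _; case: (F t) (G t) => [a b] [c d].
by apply: diffnD => //; apply: diffnM.
Qed.

Lemma smooth_on_comp U V F u : open U -> (forall t, U t -> V (u t)) ->
  smooth_on V F -> (forall n, diffn n U u) -> smooth_on U (F \o u).
Proof.
move=> oU UV /smooth_onP[FR FI] du; apply/smooth_onP; split=> n.
  exact: (diffn_comp oU UV (FR n) (du n)).
exact: (diffn_comp oU UV (FI n) (du n)).
Qed.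

Lemma open_setC_ratr (S : set rat) : finite_set S ->
  open (~` [set (ratr q : R) | q in S]).
Proof.
move=> fS; apply: closed_openC.
apply: (accessible_finite_set_closed.1 _); last exact: finite_image.
exact/hausdorff_accessible/Rhausdorff.
Qed.

End SmoothOn.

(** * Moebius maps *)

Section Moebius.
Variable K : fieldType.
Implicit Types (g h : 'M[K]_2) (x : K).

(** Stated over any field, so that a rational matrix and its image over the reals are handled alike;
    over [rat] it is [denom] by conversion. *)
Definition cocycle g x : K := g 1 0 * x + g 1 1.

Definition moebius g x : K := (g 0 0 * x + g 0 1) / cocycle g x.

Lemma sum_ord2 (F : 'I_2 -> K) : \sum_i F i = F 0 + F 1.
Proof.
by rewrite !big_ord_recl big_ord0 addr0; congr (F _ + F _); apply: val_inj.
Qed.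

Lemma det_mx2 g : \det g = g 0 0 * g 1 1 - g 0 1 * g 1 0.
Proof.
rewrite (expand_det_row g 0) sum_ord2 /cofactor !det_mx11 !mxE /=.
rewrite (_ : lift 0 0 = 1); last exact: val_inj.
rewrite (_ : lift 1 0 = 0); last exact: val_inj.
by rewrite expr0 expr1 mul1r mulN1r mulrN.
Qed.

Lemma cocycleM g h x : cocycle h x != 0 ->
  cocycle (g *m h) x = cocycle g (moebius h x) * cocycle h x.
Proof.
rewrite /moebius /cocycle !mxE !sum_ord2 => hx.
by field.
Qed.

Lemma moebiusM g h x : cocycle h x != 0 ->
  moebius (g *m h) x = moebius g (moebius h x).
Proof.
move=> hx; rewrite {1}/moebius cocycleM // [RHS]/moebius.
have -> : (g *m h) 0 0 * x + (g *m h) 0 1 =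
          (g 0 0 * moebius h x + g 0 1) * cocycle h x.
  by move: hx; rewrite /moebius /cocycle !mxE !sum_ord2 => hx; field.
by rewrite -mulf_div divff // mulr1.
Qed.

(** The denominator on the right is [\det g / cocycle g x], hence nonzero. The explicit inverse
    bounds preimages of finite sets and shows that a real point with rational image is rational. *)
Lemma moebiusK g x : \det g != 0 -> cocycle g x != 0 ->
  x = (g 1 1 * moebius g x - g 0 1) / (g 0 0 - moebius g x * g 1 0).
Proof.
rewrite det_mx2 => dg gx.
have e : g 0 0 - moebius g x * g 1 0 =
         (g 0 0 * g 1 1 - g 0 1 * g 1 0) / cocycle g x.
  by rewrite /moebius /cocycle; move: gx; rewrite /cocycle => gx; field.
have e0 : g 0 0 - moebius g x * g 1 0 != 0.
  by rewrite e mulf_neq0 // invr_eq0.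
apply: (mulIf e0); rewrite divfK // e /moebius.
by move: gx; rewrite /cocycle => gx; field.
Qed.

End Moebius.

Lemma cocycle_map (K L : fieldType) (phi : {rmorphism K -> L}) g x :
  cocycle (map_mx phi g) (phi x) = phi (cocycle g x).
Proof. by rewrite /cocycle !mxE rmorphD rmorphM. Qed.

Lemma moebius_map (K L : fieldType) (phi : {rmorphism K -> L}) g x :
  moebius (map_mx phi g) (phi x) = phi (moebius g x).
Proof. by rewrite /moebius fmorph_div -cocycle_map !mxE rmorphD rmorphM. Qed.

(** * The slash operator and functions smooth off finitely many rationals *)

Section Slash.
Variables (R : realType) (abs : bool) (k : int).
Implicit Types (g h : 'M[rat]_2) (f : rat -> R[i]) (x : rat).

Lemma slashE f g x :
  slash abs k f g x =
  (ratr (jfactor abs g x) : R[i]) ^ (- k) * f (moebius g x).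
Proof. by []. Qed.

Lemma slash_mul f g h x : cocycle h x != 0 ->
  slash abs k f (g *m h) x = slash abs k (slash abs k f g) h x.
Proof.
move=> hx; rewrite !slashE moebiusM // mulrA -expfzMl -rmorphM.
congr (ratr _ ^ _ * _); rewrite /jfactor.
rewrite -![denom _ _]/(cocycle _ _) cocycleM //.
by case: abs; rewrite ?normrM mulrC.
Qed.

Lemma slashB f1 f2 (a : R[i]) g x :
  slash abs k (fun y => f1 y - a * f2 y) g x =
  slash abs k f1 g x - a * slash abs k f2 g x.
Proof. by rewrite !slashE mulrBr mulrCA. Qed.

(** If $c=0$, a zero would force $d=0$ and a vanishing determinant; so the only possible zero is
    $-d/c$. *)
Lemma cofinite_cocycle g : \det g != 0 ->
  cofinite_set [set x | cocycle g x != 0].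
Proof.
rewrite det_mx2 => dg.
apply: (sub_finite_set _ (finite_set1 (- g 1 1 / g 1 0))) => x /= /negP/negPn/eqP.
rewrite /cocycle => gx.
have c0 : g 1 0 != 0.
  apply: contraNneq dg => c0; move: gx; rewrite c0 mul0r add0r => ->.
  by rewrite !mulr0 subr0.
apply: (mulfI c0); rewrite mulrCA divff // mulr1.
by apply/eqP; rewrite -addr_eq0 gx.
Qed.

Lemma cofinite_moebius g (P : set rat) : \det g != 0 -> cofinite_set P ->
  cofinite_set [set x | cocycle g x != 0 /\ P (moebius g x)].
Proof.
move=> dg fP; pose inv q := (g 1 1 * q - g 0 1) / (g 0 0 - q * g 1 0).
apply: (@sub_finite_set _ _ ((~` [set x | cocycle g x != 0]) `|`
                             inv @` ~` P)); last first.
  rewrite finite_setU; split; first exact: cofinite_cocycle.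
  exact: finite_image.
move=> x /= /not_andP[gx|Px]; first by left.
have [gx|gx] := boolP (cocycle g x != 0); last by left; apply/negP.
by right; exists (moebius g x) => //; rewrite /inv -moebiusK.
Qed.

(** The condition of [quantum_modular] for one group element, without the clause on poles; in this
    form it is stable under linear combinations and under slashing. *)
Definition almost_smooth (u : rat -> R[i]) : Prop :=
  exists (S : set rat) (F : R -> R[i]),
    [/\ finite_set S, smooth_on (~` [set ratr q | q in S]) F
      & forall x, ~ S x -> F (ratr x) = u x].

Lemma eq_almost_smooth u v : cofinite_set [set x | u x = v x] ->
  almost_smooth u -> almost_smooth v.
Proof.
move=> uv [S [F [fS sF Fu]]]; exists (S `|` ~` [set x | u x = v x]), F.
split; first by rewrite finite_setU.
  by apply: smooth_on_sub sF => t St [q Sq qt]; apply: St; exists q => //; left.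
by move=> x /not_orP[Sx] /contrapT /= <-; apply: Fu.
Qed.

Lemma almost_smooth_sum (J : Type) (s : seq J) (a : J -> R[i])
    (u : J -> rat -> R[i]) : (forall j, almost_smooth (u j)) ->
  almost_smooth (fun x => \sum_(j <- s) a j * u j x).
Proof.
move=> su; elim: s => [|j s [S [F [fS sF Fu]]]].
  exists set0, (fun=> 0); split=> //; first exact: smooth_on_cst.
  by move=> x _; rewrite big_nil.
have [S' [F' [fS' sF' Fu']]] := su j.
have fSS : finite_set (S' `|` S) by rewrite finite_setU.
exists (S' `|` S), (fun t => a j * F' t + F t); split=> //.
  have oU : open (~` [set (ratr q : R) | q in S' `|` S]) by apply: open_setC_ratr.
  apply: smooth_onD => //; [apply: smooth_onM => //; first exact: smooth_on_cst|].
    by apply: smooth_on_sub sF' => t St [q Sq qt]; apply: St; exists q => //; left.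
  by apply: smooth_on_sub sF => t St [q Sq qt]; apply: St; exists q => //; right.
by move=> x /not_orP[Sx Sx']; rewrite big_cons Fu // Fu'.
Qed.

(** The extension is [F] composed with the real Moebius map, times a power of the real cocycle or
    its absolute value. It is smooth off the poles and the preimages of [S], all of which are
    rational. *)
Lemma almost_smooth_slash u g : \det g != 0 -> almost_smooth u ->
  almost_smooth (slash abs k u g).
Proof.
move=> dg [S [F [fS sF Fu]]]; pose gR := map_mx (@ratr R) g.
pose P := [set x | cocycle g x != 0 /\ ~ S (moebius g x)].
have fP : cofinite_set P 
  by apply: (@cofinite_moebius g (~` S)) => //; rewrite setCK.
pose U : set R := ~` [set ratr q | q in ~` P].
have oU : open U by exact: open_setC_ratr.
have dgR : \det gR != 0 by rewrite det_map_mx fmorph_eq0.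
(* A real pole of [gR] is the rational number $-d/c$, which [U] omits. *)
have U_cocycle t : U t -> cocycle gR t != 0.
  move=> Ut; apply/negP => /eqP; rewrite /cocycle !mxE => gt.
  have c0 : g 1 0 != 0.
    move: dg; rewrite det_mx2; apply: contraNneq => c0.
    move: gt; rewrite c0 rmorph0 mul0r add0r => /eqP; rewrite fmorph_eq0 => /eqP->.
    by rewrite !mulr0 subr0.
  apply: Ut; exists (- g 1 1 / g 1 0).
    by move=> [/negP + _]; apply; rewrite /cocycle mulrCA divff // mulr1 addNr.
  have cR0 : ratr (g 1 0) != 0 :> R by rewrite fmorph_eq0.
  apply: (mulfI cR0); rewrite fmorph_div rmorphN mulrCA divff // mulr1.
  by apply/esym/eqP; rewrite -addr_eq0 gt.
(* A real point sent to a rational [q] is the rational point given by the inverse map, so if [q] is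
   in [S] it has been removed from [U]. *)
have U_moebius t : U t -> (~` [set (ratr q : R) | q in S]) (moebius gR t).
  move=> Ut [q Sq qt]; have gt := U_cocycle t Ut.
  pose x := (g 1 1 * q - g 0 1) / (g 0 0 - q * g 1 0).
  have tx : t = ratr x.
    rewrite (moebiusK dgR gt) -qt !mxE /x fmorph_div !rmorphB !rmorphM //.
  apply: Ut; exists x => // -[gx]; apply.
  suff -> : moebius g x = q by [].
  apply: (fmorph_inj (@ratr R)); rewrite -moebius_map.
  by rewrite [RHS]qt; exact: (congr1 (moebius gR) (esym tx)).
pose jR t := if abs then `|cocycle gR t| else cocycle gR t.
exists (~` P), (fun t => (jR t ^ (- k))%:C%C * F (moebius gR t)); split=> //.
  have dc n : diffn n U (cocycle gR) by apply: diffn_affine.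
  apply: smooth_onM => //; last first.
    apply: (@smooth_on_comp _ _ (~` [set (ratr q : R) | q in S])) => // n.
    apply: diffnM => //; first exact: diffn_affine.
    exact: diffn_inv.
  apply: smooth_on_real => n; apply: diffn_exprz => //.
    by move=> t /U_cocycle; rewrite /jR; case: abs; rewrite ?normr_eq0.
  rewrite /jR; case: abs => //; exact: diffn_norm.
move=> x /contrapT[gx Sx].
rewrite slashE (moebius_map (@ratr R)) Fu //; congr (_ * _).
rewrite fmorphXz; congr (_ ^ _).
rewrite /jR (cocycle_map (@ratr R)) /jfactor -[denom _ _]/(cocycle _ _).
by case: abs; rewrite -?ratr_norm fmorph_rat.
Qed.

End Slash.

(** * Cosets of congruence subgroups *)

Section Cosets.
Implicit Types (G : set 'M[int]_2) (alpha : 'M[rat]_2).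

Lemma ratmxM g h : ratmx (g *m h) = ratmx g *m ratmx h.
Proof. exact: map_mxM. Qed.

Lemma ratmx1 : ratmx 1%:M = 1%:M.
Proof. exact: map_mx1. Qed.

Lemma det_ratmx g : \det (ratmx g) = (\det g)%:~R.
Proof. exact: det_map_mx. Qed.

Lemma SL2Z_unitmx g : SL2Z g -> g \in unitmx.
Proof. by rewrite /SL2Z /= unitmxE => ->; rewrite unitr1. Qed.

Lemma SL2Z_detQ g : SL2Z g -> \det (ratmx g) = 1.
Proof. by rewrite det_ratmx => ->. Qed.

Lemma ratmx_mulVr g (A : 'M[rat]_2) : SL2Z g ->
  ratmx (invmx g) *m (ratmx g *m A) = A.
Proof.
by move=> /SL2Z_unitmx ug; rewrite mulmxA -ratmxM mulVmx // ratmx1 mul1mx.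
Qed.

Lemma clear_denominators (m n : nat) (B : 'M[rat]_(m, n)) :
  exists2 d : nat, (0 < d)%N & exists A : 'M[int]_(m, n),
    map_mx intr A = d%:R *: B.
Proof.
pose d := (\prod_(p : 'I_m * 'I_n) `|denq (B p.1 p.2)|)%N.
exists d; first by rewrite prodn_gt0 // => p; rewrite absz_gt0 denq_neq0.
exists (\matrix_(i, j) (numq (B i j) * (d %/ `|denq (B i j)|)%N%:Z)).
apply/matrixP => i j; rewrite !mxE rmorphM /= numqE.
have /dvdnP[c ->] : (`|denq (B i j)| %| d)%N.
  by rewrite /d (bigD1 (i, j)) //= dvdn_mulr.
rewrite mulnK ?absz_gt0 ?denq_neq0 // natrM.
rewrite -[`|_|%:R]/(`|_|%N%:Z%:~R) absz_denq pmulrn.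
by rewrite -!pmulrn [LHS]mulrC -mulrA [B i j * _]mulrC.
Qed.

Lemma principal_congruence_conj (N : nat) alpha : (0 < N)%N ->
  \det alpha != 0 ->
  exists2 M : nat, (0 < M)%N & forall g, principal_congruence M g ->
    exists2 h, principal_congruence N h &
      ratmx h *m alpha = alpha *m ratmx g.
Proof.
move=> N0 da.
have ua : alpha \in unitmx by rewrite unitmxE unitfE.
have [d d0 [A AE]] := clear_denominators alpha.
have [e e0 [B BE]] := clear_denominators (invmx alpha).
exists (N * d * e)%N => [|g [dg cg]]; first by rewrite !muln_gt0 N0 d0.
set M := (N * d * e)%N in cg.
pose X : 'M[int]_2 := \matrix_(i, j) ((g - 1%:M) i j %/ M%:Z)%Z.
have gE : g = 1%:M + M%:Z *: X.
  apply/matrixP => i j; have := divzK (cg i j).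
  by rewrite !mxE mulrC => ->; rewrite addrC subrK.
(* As $A=d\alpha$, $B=e\alpha^{-1}$ and $M=Nde$, the product $N\,AXB$ equals
   $\alpha(MX)\alpha^{-1}$; so [h] is $\alpha g\alpha^{-1}$ with visibly integral entries. *)
pose h : 'M[int]_2 := 1%:M + N%:Z *: (A *m X *m B).
have hE : ratmx h *m alpha = alpha *m ratmx g.
  rewrite gE /h /ratmx !map_mxD !map_mx1 !map_mxZ !map_mxM /= AE BE.
  rewrite mulmxDl mulmxDr mul1mx mulmx1; congr (_ + _).
  rewrite -!scalemxAl -!scalemxAr -!scalemxAl !scalerA.
  rewrite -!mulmxA mulVmx // mulmx1 /M.
  by rewrite !PoszM !rmorphM.

exists h => //; split; last first.
  move=> i j; rewrite /h addrC addKr // !mxE.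
  exact: dvdz_mulr.
have /eqP : \det (ratmx h) = 1.
  have /(congr1 determinant) := hE.
  rewrite !det_mulmx (SL2Z_detQ dg) mulr1 -{2}[\det alpha]mul1r.
  exact: mulIf.
by rewrite det_ratmx (@eqr_int _ (\det h) 1) => /eqP.
Qed.

(** [beta i] lies in its own orbit through the identity and in that of [beta j] through [g], so
    uniqueness of the index applies. *)
Lemma orbit_representatives_inj G alpha (J : Type) (beta : J -> 'M[rat]_2)
    i j g :
  orbit_representatives G alpha beta -> G 1%:M -> G g ->
  beta i = ratmx g *m beta j -> i = j.
Proof.
move=> [Db Ub] G1 Gg ij; have [l [_ ul]] := Ub _ (Db i).
have <- : l = i by apply: ul; exists 1%:M => //; rewrite ratmx1 mul1mx.
by apply: ul; exists g.
Qed.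

Lemma finite_orbit_representatives G alpha (J : Type) (beta : J -> 'M[rat]_2) :
  congruence_subgroup G -> \det alpha != 0 ->
  orbit_representatives G alpha beta -> finite_set [set: J].
Proof.
move=> [[GS G1 GM GV] [N N0 NG]] da Hb.
have [M M0 HM] := principal_congruence_conj N0 da.
have /choice[p pE] j : exists p : 'M[int]_2 * 'M[int]_2,
    [/\ G p.1, G p.2 & beta j = ratmx p.1 *m alpha *m ratmx p.2].
  by have [g1 [g2 [? ? ?]]] := Hb.1 j; exists (g1, g2).
case: M M0 HM => // M _ HM.
(* Entrywise residues of the right factor of [beta j], a point of a finite set; the modulus is in
   successor form so that residues live in an ordinal type. *)
pose red j : 'M['I_M.+1]_2 := map_mx (fun z => inord `|(z %% M.+1)%Z|%N) (p j).2.
have red_inj : injective red.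
  move=> i j /matrixP ij.
  have [Gi1 Gi2 Ei] := pE i; have [Gj1 Gj2 Ej] := pE j.
  pose g := (p i).2 *m invmx (p j).2.
  have Gg : G g by apply: GM => //; apply: GV.
  have cg : principal_congruence M.+1 g.
    split; first exact: GS.
    (* Written this way, each entry is a combination of entries of the difference of the two right
       factors, which are divisible by the modulus. *)
    have -> : g - 1%:M = ((p i).2 - (p j).2) *m invmx (p j).2.
      by rewrite mulmxBl mulmxV // SL2Z_unitmx //; apply: GS.
    move=> a b; rewrite mxE; apply: rpred_sum => c _; apply: dvdz_mulr.
    rewrite !mxE -eqz_mod_dvd; have := ij a c; rewrite !mxE => /(congr1 val).
    have lt_mod z : (`|(z %% M.+1)%Z| < M.+1)%N.
      by rewrite -ltz_nat gez0_abs ?modz_ge0 // ltz_pmod.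
    rewrite /= !inordK // => /(congr1 Posz); rewrite !gez0_abs ?modz_ge0 //.
    by move=> ->.
  have [h /NG Gh hE] := HM g cg.
  (* Moving [g] across [alpha] as [h], an element of [G], exhibits [beta i] in the orbit of
     [beta j]. *)
  apply: (orbit_representatives_inj (g := (p i).1 *m h *m invmx (p j).1) Hb) => //.
    exact: GM (GM _ _ Gi1 Gh) (GV _ Gj1).
  rewrite Ej Ei !ratmxM -!mulmxA ratmx_mulVr; last exact: GS.
  congr (_ *m _); rewrite mulmxA hE -mulmxA; congr (_ *m _).
  rewrite /g -ratmxM -mulmxA mulVmx ?mulmx1 //.
  exact/SL2Z_unitmx/GS.
have : finite_set (red @^-1` setT).
  by apply: finite_preimage => [i j _ _|]; [exact: red_inj|exact: finite_finset].
by [].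
Qed.

End Cosets.

(** * The function $c_{\chi,\chi'}$ on the double coset *)

(** The set given to [xget] is nonempty, so the default is not taken, and by compatibility every
    element of it has this value. *)
Lemma compat_funE (R : realType) G alpha (chi chi' : 'M[int]_2 -> R[i]) g1 g2 :
  compatible G alpha chi chi' -> G g1 -> G g2 ->
  compat_fun G alpha chi chi' (ratmx g1 *m alpha *m ratmx g2) =
  chi g1 * chi' g2.
Proof.
move=> Hc G1 G2; rewrite /compat_fun; case: xgetP => [z _|].
  by move=> [h1 [h2 [H1 H2 e ->]]]; apply: Hc.
by move=> /(_ (chi g1 * chi' g2)) []; exists g1, g2.
Qed.

Lemma compat_funMl (R : realType) G alpha (chi chi' : 'M[int]_2 -> R[i]) g b :
  is_subgroup G -> compatible G alpha chi chi' -> multiplier_system G chi ->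
  double_coset G alpha b -> G g ->
  compat_fun G alpha chi chi' (ratmx g *m b) =
  chi g * compat_fun G alpha chi chi' b.
Proof.
move=> [_ _ GM _] Hc [_ chiM] [h1 [h2 [H1 H2 ->]]] Gg.
rewrite !mulmxA -ratmxM !compat_funE ?chiM ?mulrA //.
exact: GM.
Qed.

Lemma compat_funMr (R : realType) G alpha (chi chi' : 'M[int]_2 -> R[i]) g b :
  is_subgroup G -> compatible G alpha chi chi' -> multiplier_system G chi' ->
  double_coset G alpha b -> G g ->
  compat_fun G alpha chi chi' (b *m ratmx g) =
  compat_fun G alpha chi chi' b * chi' g.
Proof.
move=> [_ _ GM _] Hc [_ chiM] [h1 [h2 [H1 H2 ->]]] Gg.
rewrite -mulmxA -ratmxM !compat_funE ?chiM ?mulrA //.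
exact: GM.
Qed.

(** * Quantum modularity of the Hecke image *)

Theorem theorem4p2 (R : realType) (abs : bool) (k : int)
    (alpha : 'M[rat]_2) (halpha : 0 < \det alpha)
    (G : set 'M[int]_2) (hG : congruence_subgroup G)
    (J : choiceType) (beta : J -> 'M[rat]_2)
    (hbeta : orbit_representatives G alpha beta)
    (chi chi' : 'M[int]_2 -> R[i])
    (hchi : multiplier_system G chi) (hchi' : multiplier_system G chi')
    (hcompat : compatible G alpha chi chi')
    (f : rat -> R[i]) (hf : quantum_modular abs k G chi f)
    (Tf : rat -> R[i])
    (hTf : hecke_image abs k G alpha chi chi' beta f Tf) :
  quantum_modular abs k G chi' Tf.
Proof.
have da : \det alpha != 0 by rewrite gt_eqF.
have finJ := finite_orbit_representatives hG da hbeta.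
have [sG _] := hG; have [GS G1 GM GV] := sG.
set c := compat_fun G alpha chi chi'.
have dg h : G h -> \det (ratmx h) != 0.
  by move=> /GS /SL2Z_detQ ->; rewrite oner_eq0.
have db j : \det (beta j) != 0.
  have [g1 [g2 [H1 H2 ->]]] := hbeta.1 j.
  by rewrite !det_mulmx !SL2Z_detQ ?mul1r ?mulr1 //; apply: GS.
move=> g Gg.
have /choice[p pE] j : exists p : J * 'M[int]_2,
    G p.2 /\ beta j *m ratmx g = ratmx p.2 *m beta p.1.
  have [g1 [g2 [H1 H2 bE]]] := hbeta.1 j.
  have [|l [[h Gh hE] _]] := hbeta.2 (beta j *m ratmx g).
    by exists g1, (g2 *m g); split=> //; [exact: GM|rewrite bE ratmxM !mulmxA].
  by exists (l, h).
pose sigma j := (p j).1; pose h j := (p j).2.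
have Gh j : G (h j) by have [] := pE j.
have bg j : beta j *m ratmx g = ratmx (h j) *m beta (sigma j) by have [] := pE j.
have ug : ratmx g \in unitmx by rewrite unitmxE unitfE dg.
have sigma_bij : bijective sigma.
  rewrite -setTT_bijective; split=> //.
    (* If [sigma i = sigma j], then $\beta_i g = h_i h_j^{-1}\beta_j g$; cancelling $g$ puts both in
       one orbit. *)
    move=> i j _ _ ij.
    apply: (orbit_representatives_inj (g := h i *m invmx (h j)) hbeta) => //.
      exact: GM (GV _ (Gh j)).
    apply: (can_inj (mulmxK ug)); rewrite ratmxM -!mulmxA !bg ij.
    by rewrite ratmx_mulVr //; apply: GS.
  (* The preimage of [j] is the index [i] of the orbit of $\beta_j g^{-1}$: if $\beta_j
     g^{-1}=l^{-1}\beta_i$ or $l\beta_i$ with $l\in\Gamma$, then $\beta_i g$ lies in the orbit of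
     $\beta_j$. *)
  move=> j _; have [g1 [g2 [H1 H2 bE]]] := hbeta.1 j.
  have [|i [[l Gl lE] _]] := hbeta.2 (beta j *m ratmx (invmx g)).
    exists g1, (g2 *m invmx g); split=> //; first exact: GM (GV _ Gg).
    by rewrite bE ratmxM !mulmxA.
  exists i => //.
  apply: (orbit_representatives_inj (g := invmx (h i) *m invmx l) hbeta) => //.
    exact: GM (GV _ (Gh i)) (GV _ Gl).
  have -> : beta j = ratmx l *m (beta i *m ratmx g).
    rewrite mulmxA -lE -mulmxA -ratmxM mulVmx ?ratmx1 ?mulmx1 //.
    exact/SL2Z_unitmx/GS.
  by rewrite bg ratmxM -mulmxA !ratmx_mulVr //; apply: GS.
(* Evaluate [c] on $\beta_j g = h_j\beta_{\sigma j}$ in both ways. *)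
have cE j : (chi' g)^-1 * (c (beta j))^-1 =
    (c (beta (sigma j)))^-1 * (chi (h j))^-1.
  rewrite -!invfM [X in X^-1 = _]mulrC [X in _ = X^-1]mulrC; congr (_^-1).
  rewrite -(compat_funMr sG hcompat hchi' (hbeta.1 j) Gg) bg.
  exact: compat_funMl sG hcompat hchi (hbeta.1 _) (Gh j).
pose s := finmap.enum_fset (fset_set [set: J]).
pose u j : rat -> R[i] :=
  fun x => f x - (chi (h j))^-1 * slash abs k f (ratmx (h j)) x.
have u_smooth j : almost_smooth (u j).
  have [S [F [fS sF Fu]]] := hf _ (Gh j).
  by exists S, F; split=> // x /Fu[].
(* On [P] no $f|\beta_j$ has a pole, so [hTf] determines [Tf]; [P] is cofinite because [J] is
   finite. *)
pose P := [set x | forall j, cocycle (beta j) x != 0].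
have fP : cofinite_set P.
  rewrite (_ : P = \bigcap_(j in [set: J]) [set x | cocycle (beta j) x != 0]).
    rewrite setC_bigcap; apply: bigcup_finite => // j _.
    exact: cofinite_cocycle.
  by apply/seteqP; split=> x /= Px j; [move=> _|]; apply: Px.
have fPg := cofinite_moebius (dg _ Gg) fP.
suff [S [F [fS sF Fu]]] : almost_smooth
    (fun x => Tf x - (chi' g)^-1 * slash abs k Tf (ratmx g) x).
  (* The pole of the slash by [g] joins the exceptional set, as [quantum_modular] requires. *)
  exists (S `|` ~` [set x | cocycle (ratmx g) x != 0]), F; split.
  - by rewrite finite_setU; split => //; apply/cofinite_cocycle/dg.
  - by apply: smooth_on_sub sF => t St [q Sq qt]; apply: St; exists q => //; left.
  - by move=> x /not_orP[Sx /contrapT]; split=> //; apply: Fu.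
apply: (@eq_almost_smooth _ (fun x => \sum_(j <- s)
    (c (beta (sigma j)))^-1 * slash abs k (u j) (beta (sigma j)) x)); last first.
  by apply: almost_smooth_sum => j; apply: almost_smooth_slash.
(* Both $x$ and $gx$ must lie in [P]: the first fixes the value of [Tf] at $x$, the second that of
   its slash by [g]. *)
apply: (@sub_cofinite_set _ (P `&`
  [set x | cocycle (ratmx g) x != 0 /\ P (moebius (ratmx g) x)])); last first.
  by rewrite cofinite_setI.
move=> x [Px [gx Pgx]] /=.
have TfE y : P y ->
    Tf y = \sum_(j <- s) (c (beta j))^-1 * slash abs k f (beta j) y.
  by move=> Py; rewrite hTf // fsbig_finite.
rewrite [slash _ _ Tf _ _]slashE (TfE _ Pgx) !mulr_sumr.
(* Reindexing only the sum for [Tf x] by [sigma] matches the two sums term by term. *)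
rewrite hTf // (reindex_fsbigT sigma) // fsbig_finite //.
rewrite -sumrB; apply: eq_bigr => j _.
rewrite /u slashB mulrBr; congr (_ - _).
(* $(f|h_j)|\beta_{\sigma j} = f|\beta_j g = (f|\beta_j)|g$, with no pole met at $x$; [cE] then
   matches the coefficients. *)
rewrite -slash_mul // -bg slash_mul // [LHS]mulrA -cE -mulrA; congr (_ * _).
by rewrite slashE mulrCA.
Qed.
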